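(* Let $G=(V,E)$ be a finite directed graph. For every passage $P$ of $G$ there is a set $\{P_1,\dots,P_n\}$ of non-empty minimal passages of $G$ such that $\bigcup_{i=1}^n P_i=P$ and $P_i\cap P_j=\emptyset$ for all $1\le i<j\le n$.
   Context: A directed graph is a pair $G=(V,E)$ with $E\subseteq V\times V$; finite means $V$ is finite. A set $P\subseteq E$ is a passage of $G$ if for every $(x,y)\in P$ and all $x',y'\in V$ with $(x,y')\in E$ and $(x',y)\in E$, we have $(x,y')\in P$ and $(x',y)\in P$. A passage $P$ is minimal if there is no non-empty passage $P'$ of $G$ with $P'\subsetneq P$. *)

(* Defs.v *)
From mathcomp Require Import all_boot.

Set Implicit Arguments.
Unset Strict Implicit.
Unset Printing Implicit Defensive.

(* A finite directed graph (V, E) is a finType V together with an edge set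
   E : {set V * V}; loops are allowed. *)

Definition passage (V : finType) (E P : {set V * V}) : Prop :=
  P \subset E /\
  forall x y : V, (x, y) \in P ->
    forall x' y' : V, (x, y') \in E -> (x', y) \in E ->
      (x, y') \in P /\ (x', y) \in P.

(* The empty set is a passage, and it is vacuously minimal. *)
Definition minimal_passage (V : finType) (E P : {set V * V}) : Prop :=
  passage E P /\
  ~ (exists P' : {set V * V}, [/\ passage E P', P' != set0 & P' \proper P]).

(* Main.v *)
Require Import Defs.
From mathcomp Require Import all_boot.

(** Passages are the sets of edges closed under the symmetric relation "same
    source or same target", so they form a Boolean algebra of subsets of [E].
    The atoms of this algebra below [P] are the required pieces: the smallest
    passage [A] containing an edge [e] is an atom, since a passage [B] inside [A]
    that misses [e] can be removed from [A]. *)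

Definition adjacent (V : finType) (e f : V * V) : bool :=
  (e.1 == f.1) || (e.2 == f.2).

(** Boolean, so that [minset] applies; both closure conditions of [passage] merge into closure under
    [adjacent]. *)
Definition passageb (V : finType) (E P : {set V * V}) : bool :=
  (P \subset E) &&
  [forall e in P, forall f in E, adjacent V e f ==> (f \in P)].

Lemma adjacent_sym (V : finType) (e f : V * V) :
  adjacent V e f = adjacent V f e.
Proof. by rewrite /adjacent eq_sym [e.2 == _]eq_sym. Qed.

Lemma passagebP (V : finType) (E P : {set V * V}) :
  reflect (P \subset E /\
           forall e f, e \in P -> f \in E -> adjacent V e f -> f \in P)
          (passageb V E P).
Proof.
apply: (iffP andP) => -[sPE clP]; split=> //.
  by move=> e f eP fE; apply/implyP; apply: (forall_inP (forall_inP clP e eP)).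
by apply/forall_inP=> e eP; apply/forall_inP=> f fE; apply/implyP; apply: clP.
Qed.

Lemma passageP (V : finType) (E P : {set V * V}) :
  reflect (passage E P) (passageb V E P).
Proof.
apply: (iffP (passagebP V E P)) => -[sPE clP]; split=> //.
  move=> x y xyP x' y' xy'E x'yE.
  by split; apply: clP xyP _ _; rewrite // /adjacent /= eqxx ?orbT.
(* In both cases the other edge that [clP] asks for is taken to be [(x, y)] itself. *)
move=> [x y] [x' y'] xyP fE /orP[] /= /eqP eq_xy.
  rewrite -eq_xy in fE *.
  by case: (clP x y xyP x y' fE (subsetP sPE _ xyP)).
rewrite -eq_xy in fE *.
by case: (clP x y xyP x' y (subsetP sPE _ xyP) fE).
Qed.

Lemma passagebI (V : finType) (E A B : {set V * V}) :
  passageb V E A -> passageb V E B -> passageb V E (A :&: B).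
Proof.
move=> /passagebP[sAE clA] /passagebP[_ clB]; apply/passagebP; split.
  exact: subset_trans (subsetIl A B) sAE.
move=> e f /setIP[eA eB] fE ef.
by rewrite inE (clA e f eA fE ef) (clB e f eB fE ef).
Qed.

(** By symmetry of [adjacent], an edge of [B] adjacent to some [e] in [A] would force [e] into
    [B]. *)
Lemma passagebD (V : finType) (E A B : {set V * V}) :
  passageb V E A -> passageb V E B -> passageb V E (A :\: B).
Proof.
move=> /passagebP[sAE clA] /passagebP[_ clB]; apply/passagebP; split.
  exact: subset_trans (subsetDl A B) sAE.
move=> e f /setDP[eA eNB] fE ef; rewrite inE (clA e f eA fE ef) andbT.
apply: contra eNB => fB; apply: (clB f e fB (subsetP sAE e eA)).
by rewrite adjacent_sym.
Qed.

(** Non-emptiness is built in, since [minimal_passage] also admits the empty set. *)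
Definition atomic_passage (V : finType) (E : {set V * V}) :
    pred {set V * V} :=
  minset (fun A => (A != set0) && passageb V E A).

Lemma atomic_passage_minimal (V : finType) (E A : {set V * V}) :
  atomic_passage V E A -> A != set0 /\ minimal_passage E A.
Proof.
case/minsetP=> /andP[A0 pA] minA; split=> //; split; first exact/passageP.
case=> B [/passageP pB B0 ltBA].
have /minA/(_ (proper_sub ltBA)) eqBA : (B != set0) && passageb V E B.
  by rewrite B0.
by rewrite eqBA properxx in ltBA.
Qed.

(** A non-empty intersection is a passage inside both atoms, hence equal to each. *)
Lemma atomic_passage_disjoint (V : finType) (E A B : {set V * V}) :
  atomic_passage V E A -> atomic_passage V E B -> A != B -> A :&: B = set0.
Proof.
case/minsetP=> /andP[_ pA] minA /minsetP[/andP[_ pB] minB].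
apply: contra_neq_eq => I0.
have pI : (A :&: B != set0) && passageb V E (A :&: B).
  by rewrite I0 passagebI.
by rewrite -{1}(minA _ pI (subsetIl A B)) (minB _ pI (subsetIr A B)).
Qed.

Lemma atomic_passage_exists (V : finType) (E P : {set V * V}) (e : V * V) :
  passageb V E P -> e \in P ->
  exists A, [/\ atomic_passage V E A, A \subset P & e \in A].
Proof.
move=> pP eP.
have ePP : (e \in P) && passageb V E P by rewrite eP.
(* [A] is minimal only among passages containing [e]; the rest of the proof treats a non-empty [B]
   inside [A] that may miss [e]. *)
have [A /minsetP[/andP[eA pA] minA] sAP] :=
  @minset_exists _ (fun A => (e \in A) && passageb V E A) P ePP.
exists A; split=> //; apply/minsetP; split.
  by rewrite pA andbT; apply/set0Pn; exists e.
move=> B /andP[/set0Pn[f fB] pB] sBA.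
have [eB | eNB] := boolP (e \in B); first by apply: minA; rewrite ?eB.
have eqD : A :\: B = A.
  by apply: minA (subsetDl A B); rewrite inE eNB eA passagebD.
by have := subsetP sBA f fB; rewrite -eqD inE fB.
Qed.

Theorem mainTheorem7 (V : finType) (E : {set V * V}) (P : {set V * V})
    (hP : passage E P) :
  exists (n : nat) (Q : 'I_n -> {set V * V}),
    [/\ forall i : 'I_n, Q i != set0 /\ minimal_passage E (Q i),
        \bigcup_(i < n) Q i = P
      & forall i j : 'I_n, i < j -> Q i :&: Q j = set0].
Proof.
pose D := [set A : {set V * V} | atomic_passage V E A & A \subset P].
have DP (i : 'I_#|D|) : atomic_passage V E (enum_val i) /\ enum_val i \subset P.
  by have := enum_valP i; rewrite inE => /andP[].
(* The family enumerates the atoms below [P] without repetition, so distinct indices give distinct,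
   hence disjoint, atoms. *)
exists #|D|, (fun i => enum_val i); split.
- by move=> i; apply: atomic_passage_minimal; case: (DP i).
- apply/eqP; rewrite eqEsubset; apply/andP; split.
    by apply/bigcupsP=> i _; case: (DP i).
  apply/subsetP=> e eP.
  have [A [atA sAP eA]] := atomic_passage_exists V E P e (introT (passageP V E P) hP) eP.
  have AD : A \in D by rewrite inE atA.
  by apply/bigcupP; exists (enum_rank_in AD A); rewrite ?enum_rankK_in.
- move=> i j lt_ij; have [atQi _] := DP i; have [atQj _] := DP j.
  apply: (atomic_passage_disjoint V E) => //.
  by rewrite (inj_eq enum_val_inj) neq_ltn lt_ij.
Qed.
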